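(* Let $Q_z$ be the linear operator on $\mathbb{C}[x_1,\ldots,x_n]^{S_n}$ defined by $Q_z\bar s_\lambda=q_\lambda(z)\bar s_\lambda$, $q_\lambda(z)=\bar s_\lambda(z,1,\ldots,1)$, for all partitions $\lambda$ of length $n$. Let $z>1$ and $0<y_1<y_2<\cdots<y_n$ be real. Then for any $f\in\mathbb{C}[x_1,\ldots,x_n]^{S_n}$ the value $[Q_zf](y)$, $y=(y_1,\ldots,y_n)$, is given by the integral $$[Q_zf](y)=\frac{(n-1)!}{(z-1)^{n-1}\,\Delta_n(y)}\int_{\Omega_x}dx\,\delta(x_1\cdots x_n-zy_1\cdots y_n)\,\Delta_n(x)\,f(x),$$ where $dx=dx_1\cdots dx_n$ and the integration domain $\Omega_x$ is defined by the inequalities $$0<y_1<x_1<y_2<\cdots<x_{n-1}<y_n<x_n.$$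
   Context: Partitions of length $n$ are $\lambda=(\lambda_1,\ldots,\lambda_n)\in\mathbb{N}^n$ with $\lambda_1\ge\cdots\ge\lambda_n\ge0$. $\Delta_n(x)=\prod_{1\le i<j\le n}(x_i-x_j)$. The Schur function is $s_\lambda(x)=\det\{x_i^{\lambda_j+n-j}\}_{i,j=1}^n/\Delta_n(x)$, and $\bar s_\lambda(x)=s_\lambda(x)/s_\lambda(1,\ldots,1)$; the $\bar s_\lambda$ form a basis of the space $\mathbb{C}[x_1,\ldots,x_n]^{S_n}$ of symmetric polynomials. Here $\delta$ is the Dirac delta function: for $c>0$, $\int_{\Omega}dx\,\delta(x_1\cdots x_n-c)\,g(x)$ denotes the integral of $g(x)/(x_1\cdots x_{n-1})$ with $x_n=c/(x_1\cdots x_{n-1})$ substituted, over all $(x_1,\ldots,x_{n-1})$ such that the resulting point $x$ lies in $\Omega$ (for $n=1$ it is $g(c)$ if $c\in\Omega$). *)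

(* Defs.v *)
From HB Require Import structures.
From mathcomp Require Import all_boot all_order all_algebra all_fingroup.
From mathcomp Require Import complex ring.
(* mpoly: its notations clash with those of mathcomp-analysis, and it must come
   first because it has its own isMeasure. *)
From mathcomp Require Import -(notations) mpoly.
From mathcomp Require Import all_classical all_reals all_analysis.

Set Implicit Arguments.
Unset Strict Implicit.
Unset Printing Implicit Defensive.

Import Order.TTheory GRing.Theory Num.Theory.

Local Open Scope classical_set_scope.
Local Open Scope ring_scope.
Local Open Scope complex_scope.

Definition vdm (A : comNzRingType) (n : nat) (x : 'I_n -> A) : A :=
  \prod_(i < n) \prod_(j < n | (i < j)%N) (x i - x j).

Definition sympoly (n : nat) (K : idomainType) := {p : mpoly n K | p \is symmetric}.

HB.instance Definition _ n K :=
  [isSub of sympoly n K for @sval (mpoly n K) (fun p => p \is symmetric)].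
HB.instance Definition _ n K := [Choice of sympoly n K by <:].
HB.instance Definition _ n K :=
  [SubChoice_isSubLmodule of sympoly n K by <:].

Definition sympoly_eval n (K : idomainType) (p : sympoly n K) (x : 'I_n -> K) : K :=
  meval x (val p).

Definition is_partition n (lam : 'I_n -> nat) : Prop :=
  forall i j : 'I_n, (i <= j)%N -> (lam j <= lam i)%N.

Definition mvar n (K : idomainType) (i : 'I_n) : mpoly n K := mpolyX K (mnm1 i).

(* Indices start at 0, so the usual exponent lam_j + n - j reads
   lam j + (n - j.+1); the subtraction never truncates. *)
Definition alternant n (K : idomainType) (lam : 'I_n -> nat) : mpoly n K :=
  \det (\matrix_(i < n, j < n) mvar K i ^+ (lam j + (n - j.+1))).

(* The quotient alternant / vdm in the ring of polynomials; existence and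
   uniqueness are [schurP] and [schur_unique], so the default 0 is never used. *)
Definition schur n (K : idomainType) (lam : 'I_n -> nat) : sympoly n K :=
  xget 0 [set s | val s * vdm (@mvar n K) = alternant K lam].

Lemma det_horner_vdm (A : comNzRingType) n (x : 'I_n -> A)
    (p : 'I_n -> {poly A}) :
  exists q, \det (\matrix_(i < n, j < n) (p j).[x i]) = q * vdm x.
Proof.
elim: n x p => [|n IHn] x p.
  by exists 1; rewrite det_mx00 /vdm big_ord0 mulr1.
have /choice [q qE] : forall j, exists r : {poly A},
    p j = r * ('X - (x ord0)%:P) + ((p j).[x ord0])%:P.
  move=> j; have /factor_theorem [r rE] :
      root (p j - ((p j).[x ord0])%:P) (x ord0).
    by rewrite /root !hornerE subrr.
  by exists r; rewrite -rE subrK.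
pose B : 'M[A]_n.+1 := \matrix_(i, j)
  (if i == ord0 then (p j).[x ord0] else (q j).[x i]).
pose L : 'M[A]_n.+1 := \matrix_(i, j)
  (if j == ord0 then 1 else if j == i then x i - x ord0 else 0).
have -> : \matrix_(i, j) (p j).[x i] = L *m B.
  apply/matrixP => i j; rewrite !mxE big_ord_recl !mxE /= mul1r.
  case: (unliftP ord0 i) => [k ->|->].
    rewrite (bigD1 k) //= !mxE /= eqxx big1 ?addr0.
      by rewrite {1}(qE j) !hornerE addrC mulrC.
    move=> l lk; rewrite !mxE /= (inj_eq lift_inj) (negPf lk) mul0r //.
  by rewrite big1 ?addr0// => k _; rewrite !mxE /= mul0r.
have detL : \det L = \prod_(i < n) (x (lift ord0 i) - x ord0).
  rewrite det_trig; last first.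
    apply/is_trig_mxP => i j ij; rewrite mxE.
    by rewrite !ifF //; apply/negbTE; apply: contraTneq ij => ->; rewrite ?ltnn.
  by rewrite big_ord_recl mxE /= mul1r; apply: eq_bigr => i _; rewrite mxE eqxx.
have /choice [r rE] : forall j, exists r,
    cofactor B ord0 j = r * vdm (fun i => x (lift ord0 i)).
  move=> j; have [r rE] := IHn (fun i => x (lift ord0 i)) (fun k => q (lift j k)).
  exists ((-1) ^+ (@ord0 n + j) * r); rewrite /cofactor -mulrA -rE.
  congr (_ * \det _); apply/matrixP => i k; by rewrite !mxE.
rewrite det_mulmx detL (expand_det_row _ ord0).
rewrite (eq_bigr (fun j => B ord0 j * r j * vdm (fun i => x (lift ord0 i))));
  last by move=> j _; rewrite -mulrA -rE.
rewrite -mulr_suml; set s := \sum_(_ < _) _.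
exists ((-1) ^+ n * s).
have -> : vdm x = \prod_(i < n) (x ord0 - x (lift ord0 i)) *
    vdm (fun i => x (lift ord0 i)).
  rewrite /vdm big_ord_recl; congr (_ * _).
    by rewrite big_mkcond big_ord_recl /= mul1r.
  apply: eq_bigr => i _; rewrite big_mkcond big_ord_recl /= mul1r -big_mkcond.
  by apply: eq_bigl => j; rewrite /bump /= !add1n ltnS.
have -> : \prod_(i < n) (x (lift ord0 i) - x ord0) =
    (-1) ^+ n * \prod_(i < n) (x ord0 - x (lift ord0 i)).
  rewrite -[n in (-1) ^+ n]card_ord -prodrN.
  by apply: eq_bigr => i _; rewrite opprB.
by ring.
Qed.

Lemma vdm_Vandermonde (A : comNzRingType) n (x : 'I_n -> A) :
  vdm x = \prod_(i < n) \prod_(j < n | (i < j)%N) (-1)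
          * \det (Vandermonde n (\row_j x j)).
Proof.
rewrite det_Vandermonde -big_split; apply: eq_bigr => i _ /=.
rewrite -big_split; apply: eq_bigr => j _ /=.
by rewrite !mxE mulN1r opprB.
Qed.

Lemma msym_mvar n (K : idomainType) (s : 'S_n) i :
  msym s (mvar K i) = mvar K (s i).
Proof.
by rewrite /mvar /msym mmapX mmap1U.
Qed.

Lemma msym_det_rows n (K : idomainType) (s : 'S_n) (M N : 'M[mpoly n K]_n) :
  (forall i j, msym s (M i j) = N (s i) j) ->
  msym s (\det M) = (-1) ^+ s * \det N.
Proof.
move=> MN; rewrite -det_map_mx.
have -> : map_mx (msym s) M = row_perm s N.
  by apply/matrixP => i j; rewrite !mxE MN.
by rewrite row_permE det_mulmx det_perm.
Qed.

Lemma msym_alternant n (K : idomainType) (s : 'S_n) lam :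
  msym s (alternant K lam) = (-1) ^+ s * alternant K lam.
Proof.
by apply: msym_det_rows => i j; rewrite !mxE rmorphXn /= msym_mvar.
Qed.

Lemma msym_vdm n (K : idomainType) (s : 'S_n) :
  msym s (vdm (@mvar n K)) = (-1) ^+ s * vdm (@mvar n K).
Proof.
rewrite vdm_Vandermonde rmorphM /= rmorph_prod /= [RHS]mulrCA; congr (_ * _).
  apply: eq_bigr => i _; rewrite rmorph_prod /=; apply: eq_bigr => j _.
  by rewrite rmorphN1.
rewrite -det_tr; apply: msym_det_rows => i j.
by rewrite !mxE rmorphXn /= msym_mvar.
Qed.

Lemma vdm_mvar_neq0 n (K : idomainType) : vdm (@mvar n K) != 0.
Proof.
apply/prodf_neq0 => i _; apply/prodf_neq0 => j ij.
rewrite subr_eq0; apply: contraTneq ij => /(congr1 (mcoeff (mnm1 i))).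
rewrite !mcoeffX eqxx; case: eqP => [/(congr1 (fun m : multinom n => m i))|_ /eqP].
  by rewrite !mnm1E eqxx; case: eqP => [->|//]; rewrite ltnn.
by rewrite oner_eq0.
Qed.

Lemma schur_unique n (K : idomainType) lam (s t : sympoly n K) :
  val s * vdm (@mvar n K) = alternant K lam ->
  val t * vdm (@mvar n K) = alternant K lam -> s = t.
Proof.
move=> <- tE; apply/val_inj; apply: (mulIf (vdm_mvar_neq0 n K)).
exact/esym.
Qed.

Lemma schurP n (K : idomainType) lam :
  val (schur K lam) * vdm (@mvar n K) = alternant K lam.
Proof.
suff [s sE] : exists s : sympoly n K,
    val s * vdm (@mvar n K) = alternant K lam.
  exact: (@xgetI _ 0 [set p : sympoly n K |
    val p * vdm (@mvar n K) = alternant K lam] s sE).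
have [q qE] := det_horner_vdm (@mvar n K) (fun j => 'X^(lam j + (n - j.+1))).
have {}qE : alternant K lam = q * vdm (@mvar n K).
  by rewrite -qE; congr (\det _); apply/matrixP => i j; rewrite !mxE !hornerE.
have qsym : q \is symmetric.
  apply/issymP => s; apply: (mulIf (vdm_mvar_neq0 n K)).
  have := msym_alternant K s lam; rewrite qE rmorphM /= msym_vdm mulrCA.
  by move/(mulfI _); apply; rewrite signr_eq0.
by exists (exist _ q qsym).
Qed.

Definition schur_bar n (K : fieldType) (lam : 'I_n -> nat) : sympoly n K :=
  (sympoly_eval (schur K lam) (fun=> 1))^-1 *: schur K lam.

Definition q_eigenvalue n (K : fieldType) (lam : 'I_n.+1 -> nat) (z : K) : K :=
  sympoly_eval (schur_bar K lam) (fun i => if i == ord0 then z else 1).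

Definition cons_pair (T : Type) n (p : T * n.-tuple T) : n.+1.-tuple T :=
  [tuple of p.1 :: p.2].

(* The library's instance of this fact is shadowed by the one for
   subprobabilities. *)
Lemma sigma_finite_product d1 d2 (T1 : measurableType d1)
    (T2 : measurableType d2) (R : realType)
    (m1 : {sigma_finite_measure set T1 -> \bar R})
    (m2 : {sigma_finite_measure set T2 -> \bar R}) :
  sigma_finite setT (m1 \x m2)%E.
Proof.
have /sigma_finiteP[F [TF ndF Foo]] := sigma_finiteT m1.
have /sigma_finiteP[G [TG ndG Goo]] := sigma_finiteT m2.
exists (fun n => F n `*` G n).
  rewrite -setXTT TF TG predeqE => -[x y]; split.
    move=> [/= [n _ Fnx] [k _ Gky]]; exists (maxn n k) => //; split.
    - by move: x Fnx; exact/subsetPset/ndF/leq_maxl.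
    - by move: y Gky; exact/subsetPset/ndG/leq_maxr.
  by move=> [n _ []/= ? ?]; split; exists n.
move=> k; have [? ?] := Foo k; have [? ?] := Goo k.
split; first exact: measurableX.
by rewrite product_measure1E// lte_mul_pinfty// ge0_fin_numE.
Qed.

Section cons_measure.
Context d (T : measurableType d) (R : realType) (n : nat).

Lemma measurable_cons_pair : measurable_fun setT (@cons_pair T n).
Proof.
exact: (@measurable_cons _ _ _ _ fst _ snd measurable_fst measurable_snd).
Qed.

Context (m1 : {sigma_finite_measure set T -> \bar R})
        (m2 : {sigma_finite_measure set (n.-tuple T) -> \bar R}).

Definition cons_measure : set (n.+1.-tuple T) -> \bar R :=
  pushforward (m1 \x m2)%E (@cons_pair T n).

Let cons_measure0 : cons_measure set0 = 0%E.
Proof. by rewrite /cons_measure /pushforward preimage_set0 measure0. Qed.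

Let cons_measure_ge0 A : (0 <= cons_measure A)%E.
Proof. by rewrite /cons_measure /pushforward measure_ge0. Qed.

Let cons_measure_sigma_additive : semi_sigma_additive cons_measure.
Proof.
move=> F mF tF mUF; rewrite /cons_measure /pushforward preimage_bigcup.
apply: measure_semi_sigma_additive.
- by move=> k; rewrite -[X in measurable X]setTI; exact: measurable_cons_pair.
- apply/trivIsetP => /= i j _ _ ij; rewrite -preimage_setI.
  by move/trivIsetP : tF => /(_ _ _ _ _ ij) ->//; rewrite preimage_set0.
- rewrite -preimage_bigcup -[X in measurable X]setTI.
  exact: measurable_cons_pair.
Qed.

HB.instance Definition _ := isMeasure.Build _ _ _ cons_measure
  cons_measure0 cons_measure_ge0 cons_measure_sigma_additive.

Let cons_measure_sigma_finite : sigma_finite setT cons_measure.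
Proof.
have [F FT Foo] := sigma_finite_product m1 m2.
pose g (t : n.+1.-tuple T) := (thead t, [tuple of behead t]).
have mg : measurable_fun setT g.
  apply/measurable_fun_pairP; split; first exact: measurable_tnth.
  exact: measurable_behead.
have gK p : g (cons_pair p) = p.
  by case: p => a t; congr pair; apply/val_inj.
exists (fun i => g @^-1` F i).
  by rewrite -preimage_bigcup -FT preimage_setT.
move=> i; have [mF Foo'] := Foo i; split.
  by rewrite -[X in measurable X]setTI; exact: mg.
rewrite /cons_measure /pushforward -comp_preimage.
by rewrite (_ : g \o _ = id) //; apply/funext.
Qed.

HB.instance Definition _ := Measure_isSigmaFinite.Build _ _ _ cons_measure
  cons_measure_sigma_finite.

End cons_measure.

(* Lebesgue measure on R^m, as the m-fold product of the measure on R *)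
Fixpoint lebesgue_tuple (R : realType) (m : nat) :
    {sigma_finite_measure set (m.-tuple (measurableTypeR R)) -> \bar R} :=
  if m is k.+1 then cons_measure (@lebesgue_measure R) (lebesgue_tuple R k)
  else \d_ (nil_tuple (measurableTypeR R)).

Definition complex_integral d (T : measurableType d) (R : realType)
    (mu : {measure set T -> \bar R}) (D : set T) (f : T -> R[i]) : R[i] :=
  Rintegral mu D (fun t => complex.Re (f t)) +i*
  Rintegral mu D (fun t => complex.Im (f t)).

Definition hypersurface_point (R : realType) m (c : R) (t : m.-tuple R) :
    m.+1.-tuple R :=
  [tuple of rcons t (c / \prod_(i < m) tnth t i)].

(* The integral over Omega of delta(x_1 ... x_{m+1} - c) g(x) dx, with the last
   variable eliminated. *)
Definition delta_integral (R : realType) m (Omega : set (m.+1.-tuple R)) (c : R)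
    (g : m.+1.-tuple R -> R[i]) : R[i] :=
  complex_integral (lebesgue_tuple R m)
    [set t | Omega (hypersurface_point c t)]
    (fun t => g (hypersurface_point c t) / (\prod_(i < m) tnth t i)%:C).

(* 0 < y_1 < x_1 < y_2 < ... < x_{n-1} < y_n < x_n *)
Definition interlacing_domain (R : realType) m (y : m.+1.-tuple R) :
    set (m.+1.-tuple R) :=
  [set x | [/\ 0 < tnth y ord0,
    forall i : 'I_m.+1, tnth y i < tnth x i
    & forall i j : 'I_m.+1, j = i.+1 :> nat -> tnth x i < tnth y j]].

(* Main.v *)
(* Write a_l(x) = det(x_i^(l_j)) with l_j = lam_j + n - j.  The Schur polynomials
   span, so it suffices to treat f = s_lam, where Delta(x) f(x) = a_l(x).  Each
   indicator of y_i < x_i < y_(i+1) is a difference of the indicators of two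
   rays; expanding the product of these differences, each term is a
   multiplicative convolution of truncated powers, invariant under permuting the
   factors, so its value depends on the chosen endpoints b_i only through
   a_l(b) and the product of the b_i.  Unless b = y two endpoints coincide and
   the determinant a_l(b) vanishes.  The remaining integral equals
   a_l(y) * sum_j z^(l_j) / prod_(k != j) (l_j - l_k), by induction on the number
   of variables.  The same divided difference gives the eigenvalue q_lam(z): one
   evaluates s_lam along a geometric progression of ratio q and lets q = 1. *)
Require Import Defs.
From HB Require Import structures.
From mathcomp Require Import all_boot all_order all_algebra all_fingroup.
From mathcomp Require Import complex ring zify.
From mathcomp Require Import -(notations) mpoly.
From mathcomp Require Import all_classical all_reals all_analysis measurable_realfun.

Set Implicit Arguments.
Unset Strict Implicit.
Unset Printing Implicit Defensive.

Import Order.TTheory GRing.Theory Num.Theory.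

Local Open Scope classical_set_scope.
Local Open Scope ring_scope.
Local Open Scope complex_scope.

(** * Divided differences of powers *)

(* Lagrange interpolation of the constant 1 at the nodes s. *)
Lemma sum_inv_prod_subr (F : fieldType) (x : F) (s : seq F) :
  s != [::] -> uniq (x :: s) ->
  \sum_(a <- s) ((x - a) * \prod_(b <- s | b != a) (a - b))^-1 =
  (\prod_(a <- s) (x - a))^-1.
Proof.
move=> s0 /= /andP[xs us].
have nz y (r : seq F) (P : pred F) : (forall b, b \in r -> P b -> y != b) ->
    \prod_(b <- r | P b) (y - b) != 0.
  move=> yr; rewrite prodf_seq_neq0; apply/allP => b br; apply/implyP => Pb.
  by rewrite subr_eq0 yr.
pose L a := \prod_(b <- s | b != a) ('X - b%:P).
have LE a y : (L a).[y] = \prod_(b <- s | b != a) (y - b).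
  by rewrite /L horner_prod; apply: eq_bigr => b _; rewrite !hornerE.
(* The interpolant minus 1 has degree below the number of nodes and vanishes at each of them, so it
   is zero; the identity is its value at [x], divided by the product of all [x - a]. *)
pose p := \sum_(a <- s) ((L a).[a])^-1 *: L a - 1.
have szL a : a \in s -> size (L a) = size s.
  move=> sa; rewrite /L -big_filter size_prod_XsubC size_filter.
  by rewrite -(count_predC (pred1 a)) count_uniq_mem// sa.
have p0 : p = 0.
  apply: (@roots_geq_poly_eq0 _ p s) => //.
    apply/allP => a sa; rewrite /root /p hornerD hornerN hornerC horner_sum.
    rewrite (big_rem a)//= hornerZ mulVf; last first.
      by rewrite LE; apply: nz => b _; rewrite eq_sym.
    rewrite big1_seq ?addr0 ?subrr// => b /andP[_]; rewrite mem_rem_uniq//.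
    move=> /andP[ba bs]; rewrite hornerZ [(L b).[a]]LE (big_rem a)//= eq_sym.
    by rewrite ba subrr mul0r mulr0.
  rewrite /p (leq_trans (size_polyD _ _))// geq_max size_polyN size_poly1.
  rewrite lt0n size_eq0 s0 andbT; apply: (leq_trans (size_sum _ _ _)).
  by apply/bigmax_leqP_seq => a sa _; rewrite (leq_trans (size_scale_leq _ _)) ?szL.
have := congr1 (fun q => q.[x]) p0; rewrite /p hornerD hornerN hornerC horner_sum.
rewrite horner0 => /eqP; rewrite subr_eq0 => /eqP pE.
rewrite -[RHS]mul1r -[X in X * _^-1]pE mulr_suml big_seq [RHS]big_seq; apply: eq_bigr => a sa.
rewrite hornerZ !LE invfM [X in _ = _ / X](big_rem a)//=.
rewrite [X in _ / (_ * X)](_ : _ = \prod_(b <- s | b != a) (x - b)).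
  rewrite invfM [RHS]mulrACA divff ?mulr1 1?mulrC//; apply: nz => b bs _.
  by apply: contraNneq xs => ->.
rewrite -[RHS]big_filter; congr bigop; exact: rem_filter.
Qed.

(* pfrac s is the divided difference of k |-> x ^ k at the nodes s. *)
Definition pfrac (F : fieldType) (s : seq nat) (x : F) : F :=
  \sum_(j <- s) x ^+ j / \prod_(k <- s | k != j) (j%:R - k%:R).

Lemma pfrac_perm (F : fieldType) (s t : seq nat) (x : F) :
  perm_eq s t -> pfrac s x = pfrac t x.
Proof.
move=> st; rewrite /pfrac (perm_big _ st); apply: eq_bigr => j _.
by rewrite (perm_big _ st).
Qed.

Lemma rmorph_pfrac (F K : fieldType) (g : {rmorphism F -> K}) s x :
  g (pfrac s x) = pfrac s (g x).
Proof.
rewrite rmorph_sum; apply: eq_bigr => j _; rewrite fmorph_div rmorphXn.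
congr (_ / _); rewrite rmorph_prod; apply: eq_bigr => k _.
by rewrite rmorphB !rmorph_nat.
Qed.

(** Partial fractions turn the weight of the new node [i] into a sum over [s], which pairs with the
    old terms. The resulting differences of powers are what an antiderivative yields between two
    endpoints. *)
Lemma pfrac_cons (F : numFieldType) (i : nat) (s : seq nat) (x : F) :
  s != [::] -> uniq (i :: s) ->
  pfrac (i :: s) x =
  \sum_(j <- s) (x ^+ i - x ^+ j) /
    ((i%:R - j%:R) * \prod_(k <- s | k != j) (j%:R - k%:R)).
Proof.
move=> s0 us; have /= /andP[is_ us'] := us; have natI : injective (fun n => n%:R : F).
  by move=> a b /eqP; rewrite eqr_nat => /eqP.
pose t : seq F := [seq n%:R | n <- s].
have tE : \sum_(j <- s) ((i%:R - j%:R) * \prod_(k <- s | k != j) (j%:R - k%:R))^-1 =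
    (\prod_(k <- s) (i%:R - k%:R))^-1 :> F.
  have := @sum_inv_prod_subr F i%:R t; rewrite /t !big_map => <-.
  - apply: eq_bigr => j _; rewrite big_map; congr (_ * _)^-1.
    by apply: eq_bigl => k; rewrite (inj_eq natI).
  - by case: (s) s0.
  - by rewrite -map_cons map_inj_uniq.
rewrite /pfrac big_cons big_cons eqxx /= -[X in x ^+ i / X]invrK.
rewrite [X in _ / X^-1](_ : _ = (\prod_(k <- s) (i%:R - k%:R))^-1); last first.
  congr _^-1; rewrite big_seq_cond [RHS]big_seq; apply: eq_bigl => k.
  by case: eqP => [->|]; rewrite ?(negPf is_) ?andbT.
rewrite invrK -tE mulr_sumr -big_split big_seq [RHS]big_seq; apply: eq_bigr => j js.
rewrite /= big_cons ifT; last by apply: contraNneq is_ => ->.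
rewrite [RHS]mulrBl; congr (_ + _); rewrite -[j%:R - i%:R]opprB !invfM invrN.
by rewrite mulNr mulrN.
Qed.

(** * Vandermonde products and specializations of Schur polynomials *)

(** Collects the factors that involve index [j]. In [j] of them this index comes second, whence the
    sign. *)
Lemma vdm_lift (A : comNzRingType) n (x : 'I_n.+1 -> A) (j : 'I_n.+1) :
  vdm x = (-1) ^+ j * \prod_(k < n) (x j - x (lift j k)) * vdm (x \o lift j).
Proof.
have -> : vdm x = \prod_(k < n.+1 | (j < k)%N) (x j - x k) *
    \prod_(i < n) ((if (lift j i < j)%N then x (lift j i) - x j else 1) *
      \prod_(k < n | (i < k)%N) (x (lift j i) - x (lift j k))).
  rewrite /vdm (bigD1_ord j) //=; congr (_ * _); apply: eq_bigr => i _.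
  rewrite big_mkcond (bigD1_ord j) //= [in RHS]big_mkcond /=; congr (_ * _).
  apply: eq_bigr => k _; congr (if _ then _ else _).
  by rewrite /= /bump; case: (leqP j i); case: (leqP j k); lia.
rewrite big_split /= mulrA; congr (_ * _).
rewrite big_mkcond (bigD1_ord j) //= ltnn mul1r -big_split /=.
pose e (i : 'I_n) : A := if (lift j i < j)%N then -1 else 1.
have -> : (-1) ^+ j = \prod_(i < n) e i.
  rewrite /e -big_mkcond prodr_const; congr (_ ^+ _).
  rewrite -[LHS]card_ord -!sum1_card.
  have jn : (j <= n)%N by rewrite -ltnS.
  rewrite (big_ord_widen n (fun=> 1%N)) //; apply: eq_bigl => i.
  rewrite -[RHS]/(bump j i < j)%N /bump; case: (leqP j i) => /=; lia.
rewrite -big_split; apply: eq_bigr => i _ /=; rewrite /e /= /bump.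
case: (leqP j i) => ji; rewrite ?add1n ?add0n.
  have -> : (i.+1 < j)%N = false by lia.
  by rewrite ltnS ji mul1r mulr1.
have -> : (j < i)%N = false by lia.
by rewrite ji mul1r mulN1r opprB.
Qed.

Lemma rmorph_vdm (A B : comNzRingType) (g : {rmorphism A -> B}) n (x : 'I_n -> A) :
  g (vdm x) = vdm (g \o x).
Proof.
rewrite rmorph_prod; apply: eq_bigr => i _; rewrite rmorph_prod.
by apply: eq_bigr => j _; rewrite rmorphB.
Qed.

Lemma eq_vdm (A : comNzRingType) n (x x' : 'I_n -> A) : x =1 x' -> vdm x = vdm x'.
Proof. by move=> e; apply: eq_bigr => i _; apply: eq_bigr => j _; rewrite !e. Qed.

Lemma vdm_neq0 (A : idomainType) n (x : 'I_n -> A) : injective x -> vdm x != 0.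
Proof.
move=> xI; apply/prodf_neq0 => i _; apply/prodf_neq0 => j ij.
by rewrite subr_eq0 (inj_eq xI) -val_eqE ltn_eqF.
Qed.

(** Index 0 contributes the factors [0 - k], and shifting the other indices by one preserves their
    differences. This is the source of the factorial in the eigenvalue. *)
Lemma vdm_ord (A : comNzRingType) n :
  vdm (fun i : 'I_n.+1 => (i : nat)%:R : A) =
  (-1) ^+ n * n`!%:R * vdm (fun i : 'I_n => (i : nat)%:R).
Proof.
rewrite (vdm_lift _ ord0) /= mul1r; congr (_ * _).
  rewrite fact_prod natr_prod big_add1 big_mkord -[n in (-1) ^+ n]card_ord -prodrN.
  by apply: eq_bigr => i _; rewrite sub0r.
rewrite /vdm; apply: eq_bigr => i _; apply: eq_bigr => j _ /=.
by rewrite /bump /= !add1n -!natr1 opprD addrACA subrr addr0.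
Qed.

(** The sign (-1)^(n(n-1)/2) between [vdm], with factors x_i - x_j for i < j, and the Vandermonde
    determinant, with factors x_j - x_i. *)
Definition vdm_sign (A : comNzRingType) n : A :=
  \prod_(i < n) \prod_(j < n | (i < j)%N) -1.

Lemma vdm_sign_sqr (A : comNzRingType) n : vdm_sign A n * vdm_sign A n = 1.
Proof.
rewrite -big_split big1// => i _; rewrite -big_split big1// => j _.
by rewrite /= mulrNN mulr1.
Qed.

Lemma rmorph_vdm_sign (A B : comNzRingType) (g : {rmorphism A -> B}) n :
  g (vdm_sign A n) = vdm_sign B n.
Proof.
rewrite rmorph_prod; apply: eq_bigr => i _; rewrite rmorph_prod.
by apply: eq_bigr => j _; rewrite rmorphN1.
Qed.

Lemma vdm_signS (A : comNzRingType) n :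
  vdm_sign A n.+1 = (-1) ^+ n * vdm_sign A n.
Proof.
rewrite /vdm_sign big_ord_recl big_mkcond big_ord_recl /= mul1r prodr_const card_ord.
congr (_ * _); apply: eq_bigr => i _; rewrite big_mkcond big_ord_recl /= mul1r.
by rewrite -big_mkcond; apply: eq_bigl => j; rewrite /bump /= !add1n ltnS.
Qed.

Lemma det_pow_vdm (A : comNzRingType) n (x : 'I_n -> A) :
  \det (\matrix_(i < n, j < n) x j ^+ i) = vdm_sign A n * vdm x.
Proof.
rewrite vdm_Vandermonde mulrA vdm_sign_sqr mul1r; congr (\det _).
by apply/matrixP => i j; rewrite !mxE.
Qed.

(** 'X^a - 1 is 'X - 1 times a geometric sum, so each pair yields one factor ['X - 1]. These are to
    be cancelled before setting 'X = 1, where the geometric sums become the exponents. *)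
Lemma vdm_expX (K : comNzRingType) n (l : 'I_n -> nat) :
  vdm (fun i => 'X^(l i) : {poly K}) =
  \prod_(i < n) \prod_(j < n | (i < j)%N) ('X - 1) *
  vdm (fun i => \sum_(k < l i) 'X^k).
Proof.
rewrite /vdm -big_split; apply: eq_bigr => i _; rewrite -big_split.
by apply: eq_bigr => j _ /=; rewrite mulrBr -!subrX1 opprB addrA subrK.
Qed.

Lemma horner1_vdm_sumX (K : comNzRingType) n (l : 'I_n -> nat) :
  (vdm (fun i => \sum_(k < l i) 'X^k : {poly K})).[1] = vdm (fun i => (l i)%:R).
Proof.
rewrite -/(horner_eval 1 _) rmorph_vdm; apply: eq_vdm => i /=.
rewrite /horner_eval horner_sum -[l i in RHS]card_ord -sumr_const.
by apply: eq_bigr => k _; rewrite hornerXn expr1n.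
Qed.

Lemma prod_subX1_neq0 (K : idomainType) n :
  \prod_(i < n) \prod_(j < n | (i < j)%N) ('X - 1 : {poly K}) != 0.
Proof. by do 2![apply/prodf_neq0 => ? _]; rewrite polyXsubC_eq0. Qed.

Section schur_mmap.
Context (n : nat) (K : idomainType) (A : comNzRingType) (g : {rmorphism K -> A}).

Lemma mmap_mvar (x : 'I_n -> A) i : mmap g x (mvar K i) = x i.
Proof. by rewrite mmapX mmap1U. Qed.

Lemma mmap_alternant (x : 'I_n -> A) (lam : 'I_n -> nat) :
  mmap g x (alternant K lam) =
  \det (\matrix_(i < n, j < n) x i ^+ (lam j + (n - j.+1))).
Proof.
rewrite -det_map_mx; congr (\det _); apply/matrixP => i j.
by rewrite !mxE rmorphXn /= mmap_mvar.
Qed.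

(** The target ring is arbitrary so that the coordinates may be polynomials in an auxiliary
    indeterminate. *)
Lemma mmap_schur (x : 'I_n -> A) (lam : 'I_n -> nat) :
  mmap g x (val (schur K lam)) * vdm x =
  \det (\matrix_(i < n, j < n) x i ^+ (lam j + (n - j.+1))).
Proof.
rewrite -mmap_alternant -schurP rmorphM /= rmorph_vdm; congr (_ * _).
by apply: eq_vdm => i /=; rewrite mmap_mvar.
Qed.

End schur_mmap.

Lemma horner_mmap n (K : comNzRingType) (x : 'I_n -> {poly K}) (p : mpoly n K) a :
  (mmap (@polyC K) x p).[a] = meval (fun i => (x i).[a]) p.
Proof.
rewrite mevalE /mmap horner_sum; apply: eq_bigr => m _.
rewrite hornerM hornerC horner_prod; congr (_ * _).
by apply: eq_bigr => i _; rewrite horner_exp.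
Qed.

Section schur_specialization.
Context (K : numFieldType).

(* Evaluating at x_i = 'X^i in K['X] turns the numerator into a Vandermonde
   determinant in the 'X^(l j); after cancelling the powers of 'X - 1 one may
   set 'X = 1. *)
Lemma schur_eval1 n (lam : 'I_n -> nat) :
  sympoly_eval (schur K lam) (fun=> 1) * vdm (fun i : 'I_n => (i : nat)%:R) =
  vdm_sign K n * vdm (fun j : 'I_n => (lam j + (n - j.+1))%:R).
Proof.
pose x (i : 'I_n) : {poly K} := 'X^i.
have := mmap_schur (@polyC K) x lam.
have -> : \matrix_(i < n, j < n) x i ^+ (lam j + (n - j.+1)) =
    \matrix_(i < n, j < n) 'X^(lam j + (n - j.+1)) ^+ i.
  by apply/matrixP => i j; rewrite !mxE -!exprM mulnC.
rewrite det_pow_vdm !vdm_expX mulrCA [RHS]mulrCA.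
move/(mulfI (prod_subX1_neq0 K n)) => /(congr1 (fun p => p.[1])).
rewrite !hornerM !horner1_vdm_sumX horner_mmap -!/(horner_eval 1 _).
rewrite rmorph_vdm_sign => <-; congr (_ * _); apply: meval_eq => i.
by rewrite /horner_eval /x hornerXn expr1n.
Qed.

(** The coordinates z, 1, 'X, ..., 'X^(n-1) become (z, 1, ..., 1) at 'X = 1. Expanding along the row
    of z leaves Vandermonde minors in the 'X^(l k), so the factors ['X - 1] cancel. *)
Lemma schur_evalz n (lam : 'I_n.+1 -> nat) z :
  let l j := (lam j + (n.+1 - j.+1))%N in
  sympoly_eval (schur K lam) (fun i => if i == ord0 then z else 1) *
    (z - 1) ^+ n * vdm (fun i : 'I_n => (i : nat)%:R) =
  vdm_sign K n *
    \sum_(j < n.+1) (-1) ^+ j * z ^+ l j * vdm (fun k => (l (lift j k))%:R).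
Proof.
move=> l; pose x (i : 'I_n.+1) : {poly K} :=
  if unlift ord0 i is Some k then 'X^k else z%:P.
have x0 : x ord0 = z%:P by rewrite /x unlift_none.
have xS k : x (lift ord0 k) = 'X^k by rewrite /x liftK.
have := mmap_schur (@polyC K) x lam.
rewrite (vdm_lift x ord0) mul1r (expand_det_row _ ord0).
have -> : vdm (x \o lift ord0) = vdm (fun i : 'I_n => 'X^i).
  by apply: eq_vdm => k /=; rewrite xS.
pose D := \prod_(i < n) \prod_(j < n | (i < j)%N) ('X - 1 : {poly K}).
rewrite [X in _ = X](_ : _ = D * \sum_(j < n.+1) (-1) ^+ j * z%:P ^+ l j *
    (vdm_sign _ n * vdm (fun k => \sum_(i < l (lift j k)) 'X^i))); last first.
  rewrite mulr_sumr; apply: eq_bigr => j _; rewrite mxE x0 /cofactor add0n -/(l j).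
  set M := row' _ _; have -> : \det M = vdm_sign _ n * (D * vdm (fun k =>
      \sum_(i < l (lift j k)) 'X^i)).
    rewrite /D -vdm_expX -det_pow_vdm; congr (\det _).
    by apply/matrixP => i k; rewrite !mxE xS -!exprM mulnC.
  by ring.
rewrite vdm_expX -/D mulrA mulrCA => /(mulfI (prod_subX1_neq0 K n)).
move=> /(congr1 (fun p => p.[1])); rewrite !hornerM horner1_vdm_sumX horner_mmap.
rewrite horner_prod (eq_bigr (fun=> z - 1)); last first.
  by move=> k _; rewrite x0 xS !hornerE expr1n.
rewrite prodr_const card_ord horner_sum mulr_sumr => zE.
rewrite (_ : sympoly_eval _ _ = meval (fun i => (x i).[1]) (val (schur K lam))).
  rewrite zE; apply: eq_bigr => j _; rewrite !hornerM horner1_vdm_sumX.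
  rewrite -!/(horner_eval 1 _) rmorph_vdm_sign rmorph_sign rmorphXn /= /horner_eval.
  by rewrite hornerC mulrCA.
apply: meval_eq => i; case: (unliftP ord0 i) => [k ->|->]; rewrite ?xS ?x0.
  by rewrite hornerXn expr1n eq_sym (negPf (neq_lift _ _)).
by rewrite hornerC eqxx.
Qed.

End schur_specialization.

Lemma sympoly_eval0 n (K : idomainType) x : sympoly_eval (0 : sympoly n K) x = 0.
Proof. exact: meval0. Qed.

Lemma sympoly_evalZ n (K : idomainType) c (f : sympoly n K) x :
  sympoly_eval (c *: f) x = c * sympoly_eval f x.
Proof. exact: mevalZ. Qed.

Lemma sympoly_evalD n (K : idomainType) (f g : sympoly n K) x :
  sympoly_eval (f + g) x = sympoly_eval f x + sympoly_eval g x.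
Proof. exact: mevalD. Qed.

Lemma sympoly_eval_schur n (K : idomainType) (x : 'I_n -> K) (lam : 'I_n -> nat) :
  sympoly_eval (schur K lam) x * vdm x =
  \det (\matrix_(i < n, j < n) x i ^+ (lam j + (n - j.+1))).
Proof. exact: (mmap_schur idfun x lam). Qed.

(** The parts decrease weakly and the staircase [n - j.+1] strictly. *)
Lemma partition_exponent_inj n (lam : 'I_n -> nat) :
  is_partition lam -> injective (fun j : 'I_n => (lam j + (n - j.+1))%N).
Proof.
move=> lamP i j lij; apply/val_inj/eqP; rewrite eqn_leq.
have := ltn_ord i; have := ltn_ord j; move: lij.
by case: (ltngtP i j) => // ij; have := lamP _ _ (ltnW ij); move: ij => /=; lia.
Qed.

(** * Eigenvalues as divided differences *)

Section q_eigenvalue.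
Context (K : numFieldType).

Lemma schur_eval1_neq0 n (lam : 'I_n -> nat) :
  is_partition lam -> sympoly_eval (schur K lam) (fun=> 1) != 0.
Proof.
move=> lamP; apply/eqP => s0; have := schur_eval1 K lam.
rewrite s0 mul0r => /esym/eqP; rewrite mulf_eq0 => /orP[/eqP sg0|].
  by have /eqP := vdm_sign_sqr K n; rewrite sg0 mul0r eq_sym oner_eq0.
apply/negP/vdm_neq0 => i j /eqP; rewrite eqr_nat => /eqP.
exact: partition_exponent_inj.
Qed.

(** Quotient of the two specializations. The Vandermonde product without index [j], divided by the
    full one, leaves the inverse product of the [l j - l k] and a sign that cancels (-1)^j. *)
Lemma q_eigenvalueE n (lam : 'I_n.+1 -> nat) (z : K) :
  is_partition lam -> z != 1 ->
  q_eigenvalue lam z = n`!%:R / (z - 1) ^+ n *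
    pfrac (codom (fun j => lam j + (n.+1 - j.+1))%N) z.
Proof.
move=> lamP z1; pose l j := (lam j + (n.+1 - j.+1))%N.
have lI : injective l by exact: partition_exponent_inj.
rewrite /q_eigenvalue /schur_bar sympoly_evalZ -/l.
have s1 := schur_eval1_neq0 lamP; set s := sympoly_eval _ (fun=> 1) in s1 *.
set sz := sympoly_eval _ _.
have V0 : vdm (fun i : 'I_n => (i : nat)%:R : K) != 0.
  by apply: vdm_neq0 => i j /eqP; rewrite eqr_nat => /eqP /val_inj.
have zn0 : (z - 1) ^+ n != 0 by rewrite expf_neq0// subr_eq0.
have sE : s * n`!%:R * vdm (fun i : 'I_n => (i : nat)%:R) =
    vdm_sign K n * vdm (fun j => (l j)%:R).
  have := schur_eval1 K lam; rewrite -/s vdm_ord vdm_signS !mulrA.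
  by rewrite [s * _]mulrC -!mulrA => /(mulfI _); apply; rewrite signr_eq0.
have szE : sz * (z - 1) ^+ n * vdm (fun i : 'I_n => (i : nat)%:R) =
    s * n`!%:R * vdm (fun i : 'I_n => (i : nat)%:R) * pfrac (codom l) z.
  rewrite schur_evalz sE -mulrA; congr (_ * _).
  rewrite /pfrac big_image /= mulr_sumr; apply: eq_bigr => j _.
  rewrite big_image_cond /= big_mkcond (bigD1_ord j) //= eqxx mul1r.
  under [X in _ = _ * (_ / X)]eq_bigr => k _.
    rewrite -!/(l _) (inj_eq lI) eq_sym neq_lift; over.
  rewrite (vdm_lift _ j) /=; set p := \prod_(_ < _) (_ - _).
  have p0 : p != 0.
    apply/prodf_neq0 => k _; rewrite subr_eq0 eqr_nat (inj_eq lI).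
    exact: neq_lift.
  rewrite -/(l j) [vdm _ in LHS](_ : _ = vdm (fun k => (l (lift j k))%:R))//.
  rewrite [X in _ = _ * X * _](_ : _ = vdm (fun k => (l (lift j k))%:R))//.
  by field.
apply: (mulfI s1); rewrite mulVKf//; apply: (mulIf zn0); apply: (mulIf V0).
by rewrite szE; field.
Qed.

End q_eigenvalue.

(** * Schur polynomials span the symmetric polynomials *)

(** Distinct natural numbers in decreasing order drop by at least 1 at each step. The gap [j - i]
    keeps the parts weakly decreasing once the staircase is subtracted. *)
Lemma sorting_perm n (l : 'I_n -> nat) : injective l ->
  exists s : 'S_n, forall i j : 'I_n, (i <= j)%N -> (l (s j) + (j - i) <= l (s i))%N.
Proof.
move=> lI; pose t := [tuple l i | i < n].
have /tuple_permP[s tE] : perm_eq (sort geq t) t by rewrite perm_sort.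
exists s; pose a := nth 0 (sort geq t).
have aE (i : 'I_n) : a i = l (s i).
  rewrite /a tE (nth_map i) ?size_enum_ord// nth_ord_enum.
  by rewrite tnth_mktuple.
have szt : size (sort geq t) = n by rewrite size_sort size_tuple.
have ut : uniq (sort geq t).
  by rewrite sort_uniq map_inj_uniq ?enum_uniq.
have ageq : sorted geq (sort geq t).
  by apply: sort_sorted => i j; exact: leq_total.
have adec i : (i.+1 < n)%N -> (a i.+1 < a i)%N.
  move=> i1; rewrite ltn_neqAle; apply/andP; split.
    by rewrite nth_uniq ?szt// ?(ltn_trans _ i1)// gtn_eqF.
  have /sortedP := ageq; apply; rewrite szt; exact: i1.
move=> i j ij; rewrite -!aE.
have : (j < n)%N by []; rewrite -(subnKC ij).
elim: (j - i)%N => [|k IHk]; first by rewrite addn0 subnn addn0.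
rewrite addnS => ikn; have := adec _ ikn; have := IHk (ltnW ikn).
by rewrite subSn ?leq_addr// addKn; lia.
Qed.

(* f * vdm is antisymmetric, so n! f * vdm is the antisymmetrization of its
   monomials, that is, a combination of alternants. *)
Lemma sympoly_schur_ind (K : numFieldType) n (P : sympoly n K -> Prop) :
  P 0 -> (forall f g, P f -> P g -> P (f + g)) ->
  (forall c f, P f -> P (c *: f)) ->
  (forall lam, is_partition lam -> P (schur K lam)) ->
  forall f, P f.
Proof.
move=> P0 PD PZ PS f; pose W := vdm (@mvar n K).
pose alt (l : 'I_n -> nat) : mpoly n K := \det (\matrix_(i < n, j < n) mvar K i ^+ l j).
pose span q := exists2 g, P g & val g * W = q.
have signZ (b : bool) (p : mpoly n K) : (-1) ^+ b *: p = (-1) ^+ b * p.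
  by case: b; rewrite ?expr1 ?expr0 ?scaleN1r ?scale1r ?mulN1r ?mul1r.
have span0 : span 0 by exists 0; rewrite // raddf0 mul0r.
have spanD p q : span p -> span q -> span (p + q).
  by move=> [g Pg <-] [h Ph <-]; exists (g + h); rewrite ?raddfD ?mulrDl//; exact: PD.
have spanZ c q : span q -> span (c *: q).
  by move=> [g Pg <-]; exists (c *: g); [exact: PZ|rewrite -scalerAl].
have span_alt l : span (alt l).
  have [/injectiveP lI|] := boolP (injectiveb l); last first.
    move=> /injectivePn[i [j ij lij]]; rewrite /alt -det_tr.
    by rewrite (determinant_alternate ij)// => k; rewrite !mxE lij.
  have [s sP] := sorting_perm lI.
  (* The sorted exponents minus the staircase; comparison with the last index, in [lP], shows that
     the subtraction does not truncate. *)
  pose lam (j : 'I_n) := (l (s j) - (n - j.+1))%N.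
  have lP (j : 'I_n) : (n - j.+1 <= l (s j))%N.
    have jn := ltn_ord j; have n0 : (n.-1 < n)%N by lia.
    by have := sP j (Ordinal n0); rewrite /=; lia.
  have lamP : is_partition lam.
    move=> i j ij; have := sP i j ij; have := lP i; have := lP j; rewrite /lam.
    by have := ltn_ord j; lia.
  have -> : alt l = (-1) ^+ s *: (val (schur K lam) * W).
    have aE : alternant K lam = alt l * (-1) ^+ s.
      rewrite -odd_permV -det_perm -det_mulmx -col_permE; congr (\det _).
      by apply/matrixP => i j; rewrite !mxE subnK.
    by rewrite schurP aE signZ mulrCA -expr2 sqrr_sign mulr1.
  by apply: spanZ; exists (schur K lam) => //; exact: PS.
have spanS (r : seq (multinom n)) (F : multinom n -> mpoly n K) : (forall m, span (F m)) ->
    span (\sum_(m <- r) F m).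
  by move=> Fm; elim/big_ind: _.
have [g Pg] : span (n`!%:R^-1 *: \sum_(m <- msupp (val f * W))
    mcoeff m (val f * W) *: alt (fun i => m i)).
  by apply/spanZ/spanS => m; exact/spanZ/span_alt.
suff -> : n`!%:R^-1 *: \sum_(m <- msupp (val f * W))
    mcoeff m (val f * W) *: alt (fun i => m i) = val f * W.
  by move=> /(mulIf (vdm_mvar_neq0 n K))/val_inj <-.
apply: (scalerI (a := n`!%:R)); first by rewrite pnatr_eq0 -lt0n fact_gt0.
rewrite scalerA divff ?scale1r; last by rewrite pnatr_eq0 -lt0n fact_gt0.
have signed_msymE (s : 'S_n) (p : mpoly n K) :
    (-1) ^+ s *: msym s p = \sum_(m <- msupp p) (-1) ^+ s *: (mcoeff m p *: msym s (mpolyX K m)).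
  rewrite -scaler_sumr {1}(mpolyE p); congr (_ *: _).
  by rewrite raddf_sum; apply: eq_bigr => m _; exact: msymZ.
(* Expanded into monomials, the antisymmetrization is a sum of alternants. On the other hand each of
   its terms equals [val f * W], as [f] is symmetric and [W] antisymmetric. *)
transitivity (\sum_(s : 'S_n) (-1) ^+ s *: msym s (val f * W)).
  under [RHS]eq_bigr => s _ do rewrite signed_msymE.
  rewrite exchange_big; apply: eq_bigr => m _ /=.
  under [RHS]eq_bigr do rewrite scalerA mulrC -scalerA.
  rewrite -scaler_sumr; congr (_ *: _); rewrite /alt -det_tr; apply: eq_bigr => s _.
  rewrite mpolyXE_id rmorph_prod.
  rewrite signZ; congr (_ * _); apply: eq_bigr => i _.
  by rewrite !mxE rmorphXn /= -/(mvar K i) msym_mvar.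
rewrite (eq_bigr (fun=> val f * W)) => [|s _].
  by rewrite sumr_const card_Sn scaler_nat.
rewrite rmorphM /= msym_vdm; have /issymP -> := valP f.
by rewrite mulrCA signZ; exact: signrMK.
Qed.

(** * Integrals of truncated monomials *)

Section one_variable.
Import numFieldNormedType.Exports.
Context (R : realType).
Implicit Types (x k a b : R) (i j : nat) (s : seq nat).

(** The exponent i - j may be negative, hence the quotient of natural powers. *)
Lemma is_derive_expr_div x i j : x != 0 ->
  is_derive x 1 (fun t => t ^+ i / t ^+ j) ((i%:R - j%:R) * (x ^+ i / x ^+ j.+1)).
Proof.
move=> x0; have dX n : is_derive x 1 (fun t : R => t ^+ n) (n%:R * x ^+ n.-1).
  rewrite (_ : (fun t : R => t ^+ n) = (id : R -> R) ^+ n); last first.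
    by apply/funext => t; rewrite fctE.
  have := is_deriveX n (is_derive_id x 1); rewrite /= => /is_derive_eq; apply.
  by rewrite /GRing.scale /= mulr1.
have dV : is_derive x 1 (fun t : R => (t ^+ j)^-1) (- (j%:R / x ^+ j.+1)).
  have := is_deriveV _ (dX j); rewrite expf_neq0// => /(_ isT)/is_derive_eq; apply.
  case: j => [|j]; first by rewrite /GRing.scale /= !mul0r mulr0 oppr0.
  rewrite /GRing.scale /= !exprS; field.
  by rewrite x0 expf_neq0.
have /is_derive_eq := is_deriveM (dX i) dV; apply; rewrite /GRing.scale /=.
case: i {dX} => [|i]; first by rewrite !mul0r mulr0 addr0; ring.
by rewrite /= !exprS; field; rewrite x0 expf_neq0.
Qed.

Lemma is_derive_sum_seq (I : eqType) (r : seq I) (c : I -> R) (F : I -> R -> R)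
    (dF : I -> R) x :
  (forall u, u \in r -> is_derive x 1 (F u) (dF u)) ->
  is_derive x 1 (fun t => \sum_(u <- r) c u * F u t) (\sum_(u <- r) c u * dF u).
Proof.
elim: r => [|v r IHr] dFr.
  under eq_fun do rewrite big_nil; rewrite big_nil; exact: is_derive_cst.
under eq_fun do rewrite big_cons; rewrite big_cons.
apply: (@is_deriveD _ _ _ (fun t => c v * F v t)).
  exact/is_deriveZ/dFr/mem_head.
by apply: IHr => l lr; apply: dFr; rewrite inE lr orbT.
Qed.

(** Termwise integration of x^(i-j-1) gives differences of powers, which [pfrac_cons] reassembles:
    one integration against dx/x adds one node. As [i] is not in [s], no logarithm occurs. *)
Lemma integral_pfrac i s (cl : bool) k a b : s != [::] -> uniq (i :: s) -> 0 < a < b ->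
  (\int[lebesgue_measure]_(x in [set` Interval (BSide cl a) (BLeft b)])
    (k * (x ^+ i / x * pfrac s (b / x)))%:E = (k * (a ^+ i * pfrac (i :: s) (b / a)))%:E)%E.
Proof.
move=> s0 us /andP[a0 ab].
pose D j : R := \prod_(n <- s | n != j) (j%:R - n%:R).
pose c j := k * b ^+ j / ((i%:R - j%:R) * D j).
pose F (x : R) : R := \sum_(j <- s) c j * (x ^+ i / x ^+ j).
pose f (x : R) : R := \sum_(j <- s) c j * ((i%:R - j%:R) * (x ^+ i / x ^+ j.+1)).
have D0 j : D j != 0.
  rewrite prodf_seq_neq0; apply/allP => n _; apply/implyP.
  by rewrite eq_sym subr_eq0 eqr_nat.
have ij j : j \in s -> i%:R - j%:R != 0 :> R.
  by move: us => /= /andP[si _] sj; rewrite subr_eq0 eqr_nat; apply: contraNneq si => ->.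
have fE x : k * (x ^+ i / x * pfrac s (b / x)) = f x.
  rewrite /f /pfrac 2!mulr_sumr big_seq [RHS]big_seq; apply: eq_bigr => j js.
  (* At 0 both sides vanish because the inverse of 0 is 0. *)
  have [->|x0] := eqVneq x 0; first by rewrite exprS invr0 !(mulr0,mul0r,invr0).
  rewrite -/(D j) exprMn exprVn /c exprS; field.
  by rewrite ij// D0 x0 expf_neq0.
under eq_integral do rewrite fE.
have dF x : a <= x -> is_derive x 1 F (f x).
  move=> ax; apply: is_derive_sum_seq => j _; apply: is_derive_expr_div.
  by rewrite gt_eqF// (lt_le_trans a0).
have df x : a <= x -> derivable f x 1.
  move=> ax; rewrite (_ : f = fun x => \sum_(j <- s)
      (c j * (i%:R - j%:R)) * (x ^+ i / x ^+ j.+1)); last first.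
    by apply/funext => t; apply: eq_bigr => j _; exact: mulrA.
  have x0 : x != 0 by rewrite gt_eqF// (lt_le_trans a0).
  have dj j : j \in s -> is_derive x 1 (fun t => t ^+ i / t ^+ j.+1)
      ((i%:R - j.+1%:R) * (x ^+ i / x ^+ j.+2)).
    by move=> _; exact: is_derive_expr_div.
  by case: (is_derive_sum_seq (fun j => c j * (i%:R - j%:R)) dj).
have cf : {within `[a, b], continuous f}.
  by apply: derivable_within_continuous => x /itvP xab; apply: df; rewrite xab.
have cF x : a <= x -> {for x, continuous F}.
  by move=> /dF[dFx _]; apply/differentiable_continuous/derivable1_diffP.
have mf : measurable_fun `]a, b[ (EFin \o f).
  apply/measurable_EFinP; apply: (measurable_funS (E := `[a, b])) => //.
    by apply: subset_itvW.
  exact: subspace_continuous_measurable_fun.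
(* Endpoints have measure zero, so the integral may be taken over the closed interval. *)
rewrite (integral_itv_bndoo cl true)// -(integral_itv_bndoo true false)//.
rewrite (continuous_FTC2 (F := F))//; first last.
- by move=> x /itvP xab; rewrite derive1E; case: (dF x); rewrite ?xab.
- split.
  + by move=> x /itvP xab; case: (dF x); rewrite ?xab.
  + exact/cvg_at_right_filter/cF.
  + exact/cvg_at_left_filter/cF/ltW.
rewrite -EFinB; congr EFin.
rewrite /F pfrac_cons// 2!mulr_sumr -sumrB big_seq [RHS]big_seq; apply: eq_bigr => j js.
have b0 := lt_trans a0 ab.
rewrite /c -/(D j) !exprMn !exprVn; field.
by rewrite ij// D0 !expf_neq0 ?gt_eqF.
Qed.

End one_variable.

(** * Iterated integrals over tuples *)

Section tuple_integral.
Context (R : realType).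

Lemma measurable_invr : measurable_fun setT (@GRing.inv R).
Proof.
rewrite -(setUv [set 0]); apply/measurable_funU => //; first exact: measurableC.
split; first exact: measurable_fun_set1.
apply: open_continuous_measurable_fun; first exact/closed_openC/closed_eq.
by move=> x /set_mem/eqP; exact: inv_continuous.
Qed.

Lemma ge0_integral_lebesgue_tupleS m (f : m.+1.-tuple (measurableTypeR R) -> \bar R) :
  measurable_fun setT f -> (forall t, 0 <= f t)%E ->
  (\int[lebesgue_tuple R m.+1]_t f t =
   \int[lebesgue_measure]_x \int[lebesgue_tuple R m]_t f (cons_pair (x, t)))%E.
Proof.
move=> mf f0.
transitivity (\int[pushforward (lebesgue_measure \x lebesgue_tuple R m)%E
    (@cons_pair (measurableTypeR R) m)]_t f t)%E.
  by [].
rewrite ge0_integral_pushforward//; last exact: measurable_cons_pair.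
rewrite preimage_setT fubini_tonelli1//; last by move=> p; exact: f0.
by apply: measurableT_comp => //; exact: measurable_cons_pair.
Qed.

Section monomial_kernel.
Context (m : nat) (l : 'I_m -> nat) (cl : 'I_m -> bool) (a : 'I_m -> R).
Context (p : nat) (b c : R).

(** Integrand of the convolution, with respect to dx/x, of powers truncated to rays; the last power
    is taken at the remaining coordinate. The flag [cl i] makes a ray closed, so that an open
    interval is exactly a difference of two rays. *)
Definition ray_monomial (t : m.-tuple R) : R :=
  \prod_(i < m) (tnth t i ^+ l i / tnth t i * (a i < tnth t i ?<= if cl i)%R%:R) *
  ((c / \prod_(i < m) tnth t i) ^+ p * (b < c / \prod_(i < m) tnth t i)%R%:R).

Lemma ray_monomial_ge0 t : (forall i, 0 < a i) -> 0 < b -> 0 <= ray_monomial t.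
Proof.
move=> a0 b0; apply: mulr_ge0.
  apply: prodr_ge0 => i _; case: (boolP (_ < _ ?<= if _)) => [at_|_].
    have t0 : 0 < tnth t i by rewrite (lt_le_trans (a0 i))// (lteifW at_).
    by rewrite mulr1 divr_ge0 ?exprn_ge0// ltW.
  by rewrite mulr0.
case: ltP => [bt|_]; last by rewrite mulr0.
by rewrite mulr1 exprn_ge0// ltW// (lt_trans b0).
Qed.

Lemma measurable_ray_monomial :
  measurable_fun setT (ray_monomial : m.-tuple (measurableTypeR R) -> R).
Proof.
have mt (i : 'I_m) : measurable_fun setT (fun t : m.-tuple (measurableTypeR R) => tnth t i).
  exact: measurable_tnth.
have mV (g : m.-tuple (measurableTypeR R) -> R) : measurable_fun setT g ->
    measurable_fun setT (fun t => (g t)^-1).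
  by move=> mg; apply: measurableT_comp => //; exact: measurable_invr.
have mN (g : m.-tuple (measurableTypeR R) -> bool) : measurable_fun setT g ->
    measurable_fun setT (fun t => (g t)%:R : R).
  move=> mg; rewrite (_ : (fun t => _) = (fun t => if g t then 1 else 0 : R)).
    exact: measurable_fun_ifT.
  by apply/funext => t; case: (g t).
have mc : measurable_fun setT
    (fun t : m.-tuple (measurableTypeR R) => c / \prod_(i < m) tnth t i).
  by apply: measurable_funM => //; apply: mV; apply: measurable_prod => i _; exact: mt.
apply: measurable_funM; last first.
  apply: measurable_funM; first exact: measurable_funX.
  by apply: mN; exact: measurable_fun_ltr.
apply: measurable_prod => i _; have mti := mt i; apply: measurable_funM.
  by apply: measurable_funM; [exact: measurable_funX|exact: mV].
apply: mN; case: (cl i); rewrite /Order.lteif.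
  exact: measurable_fun_ler.
exact: measurable_fun_ltr.
Qed.

End monomial_kernel.

(* A multiplicative convolution of truncated powers, computed by peeling off one
   factor at a time. *)
Lemma integral_ray_monomial m (l : 'I_m -> nat) (cl : 'I_m -> bool) (a : 'I_m -> R)
    (p : nat) (b c : R) :
  uniq (rcons (codom l) p) -> (forall i, 0 < a i) -> 0 < b -> 0 < c ->
  (\int[lebesgue_tuple R m]_t (ray_monomial l cl a p b c t)%:E =
  (\prod_i a i ^+ l i * b ^+ p * ((\prod_i a i * b < c)%R%:R *
     pfrac (rcons (codom l) p) (c / (\prod_i a i * b))))%:E)%E.
Proof.
elim: m => [|m IHm] in l cl a c *.
  (* With no variable left the measure is a point mass, and the divided difference at the single
     node [p] is the power itself. *)
  move=> _ _ b0 c0; rewrite integral_dirac//; last first.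
    by apply/measurable_EFinP; exact: measurable_ray_monomial.
  rewrite diracT mul1e /ray_monomial !big_ord0 !mul1r divr1; congr EFin.
  have -> : codom l = [::] by apply: size0nil; rewrite size_codom card_ord.
  rewrite /pfrac /= big_seq1 big_mkcond big_seq1 eqxx divr1 expr_div_n.
  by set e : R := _%:R; field; rewrite expf_neq0// gt_eqF.
have -> : codom l = l ord0 :: codom (l \o lift ord0).
  by rewrite !codomE enum_ordSl /= -map_comp.
rewrite rcons_cons => us a0 b0 c0.
rewrite ge0_integral_lebesgue_tupleS; last 2 first.
- by apply/measurable_EFinP; exact: measurable_ray_monomial.
- by move=> t; rewrite lee_fin ray_monomial_ge0.
set s := rcons _ _ in us *; have us' : uniq s by case/andP: us.
pose P := \prod_i a (lift ord0 i) * b.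
pose A := \prod_i a (lift ord0 i) ^+ l (lift ord0 i) * b ^+ p.
have P0 : 0 < P by rewrite mulr_gt0// prodr_gt0.
have consE x t : ray_monomial l cl a p b c (cons_pair (x, t)) =
    x ^+ l ord0 / x * (a ord0 < x ?<= if cl ord0)%R%:R *
    ray_monomial (l \o lift ord0) (cl \o lift ord0) (a \o lift ord0) p b (c / x) t.
  rewrite /ray_monomial !big_ord_recl tnth0 /= -!mulrA; congr (_ * (_ * (_ * _))).
  have tS i : tnth (cons_pair (x, t)) (lift ord0 i) = tnth t i by rewrite tnthS.
  have -> : \prod_(i < m) tnth (cons_pair (x, t)) (lift ord0 i) = \prod_(i < m) tnth t i.
    by apply: eq_bigr => i _; exact: tS.
  by rewrite invfM; congr (_ * _); apply: eq_bigr => i _; rewrite tS.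
(* By induction with [c / x] for [c], the inner integral vanishes unless x < c / P, so the outer
   variable runs from [a ord0] to [c / P]. *)
transitivity (\int[lebesgue_measure]_(x in
    [set` Interval (BSide (cl ord0) (a ord0)) (BLeft (c / P)%R)])
    (A * (x ^+ l ord0 / x * pfrac s (c / P / x)))%:E)%E.
  rewrite [RHS]integral_mkcond; apply: eq_integral => x _; rewrite patchE.
  under eq_integral do rewrite consE.
  rewrite mem_setE in_itv /=; case: (boolP (_ < _ ?<= if _)) => [ax|_]; last first.
    under eq_integral do rewrite mulr0 mul0r; by rewrite integral0.
  have x0 : 0 < x by rewrite (lt_le_trans (a0 ord0))// (lteifW ax).
  under eq_integral do rewrite mulr1 EFinM.
  rewrite ge0_integralZl_EFin//; last 3 first.
  - by move=> t _; rewrite lee_fin ray_monomial_ge0//= => i.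
  - by apply/measurable_EFinP; exact: measurable_ray_monomial.
  - by rewrite divr_ge0 ?exprn_ge0// ltW.
  rewrite IHm//; [|by move=> i /=|exact: divr_gt0].
  rewrite -/P ltr_pdivlMr// [P * x]mulrC -ltr_pdivlMr//=.
  case: ltP => _; last by rewrite mul0r mulr0 mule0.
  rewrite mul1r -EFinM -/A mulrCA; congr (_ * (_ * pfrac _ _))%:E.
  by rewrite mulrAC.
have PE : \prod_i a i * b = a ord0 * P by rewrite big_ord_recl mulrA.
have AE : \prod_i a i ^+ l i * b ^+ p = a ord0 ^+ l ord0 * A.
  by rewrite big_ord_recl mulrA.
rewrite PE AE -ltr_pdivlMr//; case: ltP => aP.
  rewrite integral_pfrac//; last 2 first.
  - by rewrite /s; case: (codom _).
  - by rewrite a0.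
  by rewrite mul1r [a ord0 * P]mulrC [(P * _)^-1]invfM [c * (_ * _)]mulrA [_ * A]mulrC mulrA.
rewrite set_itv_ge ?integral_set0 ?mul0r ?mulr0//.
by case: (cl _); rewrite bnd_simp -leNgt.
Qed.

End tuple_integral.

(** * Integration over the interlacing domain *)

Section complex_integral_linear.
Context d (T : measurableType d) (R : realType) (mu : {measure set T -> \bar R}).
Implicit Types (g h : T -> R[i]) (u v : R[i]).

(** Integrability accompanies the value because additivity of the integral depends on it. *)
Definition has_complex_integral g v :=
  [/\ mu.-integrable setT (EFin \o (@complex.Re R \o g)),
      mu.-integrable setT (EFin \o (@complex.Im R \o g)) &
      complex_integral mu setT g = v].

Lemma has_complex_integral0 : has_complex_integral (fun=> 0) 0.
Proof.
split; [exact: integrable0|exact: integrable0|].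
by rewrite /complex_integral /Rintegral integral0.
Qed.

Lemma has_complex_integralD g h u v :
  has_complex_integral g u -> has_complex_integral h v ->
  has_complex_integral (fun t => g t + h t) (u + v).
Proof.
have DE : (@complex.Re R \o (fun t => g t + h t) =
      (fun t => complex.Re (g t) + complex.Re (h t))) /\
    (@complex.Im R \o (fun t => g t + h t) =
      (fun t => complex.Im (g t) + complex.Im (h t))).
  by split; apply/funext => t /=; case: (g t) (h t) => ? ? [].
case: DE => ReE ImE [gR gI gu] [hR hI hv]; split.
- by rewrite ReE; exact: integrableD gR hR.
- by rewrite ImE; exact: integrableD gI hI.
rewrite -gu -hv /complex_integral.
rewrite -[X in Rintegral _ _ X +i* _ = _]/(@complex.Re R \o _) ReE.
rewrite -[X in _ +i* Rintegral _ _ X = _]/(@complex.Im R \o _) ImE.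
by rewrite !RintegralD.
Qed.

Lemma has_complex_integralZ c g v :
  has_complex_integral g v -> has_complex_integral (fun t => c * g t) (c * v).
Proof.
have ZE : (@complex.Re R \o (fun t => c * g t) = (fun t =>
      complex.Re c * complex.Re (g t) - complex.Im c * complex.Im (g t))) /\
    (@complex.Im R \o (fun t => c * g t) = (fun t =>
      complex.Re c * complex.Im (g t) + complex.Im c * complex.Re (g t))).
  by split; apply/funext => t /=; case: (c) (g t) => ? ? [] ? ? /=.
case: ZE => ReE ImE [gR gI gv].
have Zi k (e : T -> R) : mu.-integrable setT (EFin \o e) ->
    mu.-integrable setT (EFin \o (fun t => k * e t)).
  by move=> ie; exact: (integrableZl _ k ie).
split.
- by rewrite ReE; exact: integrableB (Zi _ _ gR) (Zi _ _ gI).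
- by rewrite ImE; exact: integrableD (Zi _ _ gI) (Zi _ _ gR).
rewrite -gv /complex_integral.
rewrite -[X in Rintegral _ _ X +i* _ = _]/(@complex.Re R \o _) ReE.
rewrite -[X in _ +i* Rintegral _ _ X = _]/(@complex.Im R \o _) ImE.
rewrite RintegralB ?RintegralD ?RintegralZl//; try exact: Zi.
by case: c ReE ImE => ? ? _ _.
Qed.

Lemma has_complex_integral_sum (I : Type) (r : seq I) (g : I -> T -> R[i])
    (v : I -> R[i]) : (forall i, has_complex_integral (g i) (v i)) ->
  has_complex_integral (fun t => \sum_(i <- r) g i t) (\sum_(i <- r) v i).
Proof.
move=> gv; elim: r => [|i r IHr].
  by under eq_fun do rewrite big_nil; rewrite big_nil; exact: has_complex_integral0.
under eq_fun do rewrite big_cons; rewrite big_cons.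
exact: has_complex_integralD.
Qed.

Lemma ge0_has_complex_integral (h : T -> R) (r : R) :
  measurable_fun setT h -> (forall t, 0 <= h t) ->
  (\int[mu]_t (h t)%:E = r%:E)%E -> has_complex_integral (fun t => (h t)%:C) r%:C.
Proof.
move=> mh h0 hr; split => //=.
- apply/integrableP; split; first exact/measurable_EFinP.
  by under eq_integral do rewrite /= ger0_norm//; rewrite hr ltry.
- exact: integrable0.
by rewrite /complex_integral /Rintegral /= integral0 hr.
Qed.

Lemma complex_integral_mkcond (D : set T) g :
  complex_integral mu D g = complex_integral mu setT (fun t => g t * (t \in D)%:R).
Proof.
rewrite /complex_integral; congr (_ +i* _); rewrite Rintegral_mkcond;
  apply: eq_Rintegral => t _; rewrite patchE;
  by case: (t \in D); rewrite ?mulr1 ?mulr0.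
Qed.

End complex_integral_linear.

(** * Alternants over the interlacing domain *)

Section alternant_integral.
Context (R : realType) (m : nat).

Lemma tnth_hypersurface_lift c (t : m.-tuple R) k :
  tnth (hypersurface_point c t) (lift ord_max k) = tnth t k.
Proof.
by rewrite !(tnth_nth 0) lift_max /= nth_rcons size_tuple ltn_ord.
Qed.

Lemma tnth_hypersurface_max c (t : m.-tuple R) :
  tnth (hypersurface_point c t) ord_max = c / \prod_(i < m) tnth t i.
Proof. by rewrite (tnth_nth 0) /= nth_rcons size_tuple ltnn eqxx. Qed.

Lemma big_ord_lift_max (A : comPzSemiRingType) (F : 'I_m.+1 -> A) :
  \prod_i F i = \prod_k F (lift ord_max k) * F ord_max.
Proof. by rewrite (bigD1_ord ord_max)//= mulrC. Qed.

(** With [pfrac_perm], this makes all terms of a determinant expansion share one divided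
    difference. *)
Lemma perm_codom_lift_max (l : 'I_m.+1 -> nat) (s : 'S_m.+1) : injective l ->
  perm_eq (rcons (codom (fun k => l (s (lift ord_max k)))) (l (s ord_max))) (codom l).
Proof.
move=> lI; apply: uniq_perm.
- rewrite rcons_uniq map_inj_uniq ?enum_uniq ?andbT; last first.
    by move=> i j /lI/perm_inj/lift_inj.
  apply/codomP => -[k /lI/perm_inj/eqP]; apply/negP; exact: neq_lift.
- by rewrite map_inj_uniq ?enum_uniq.
move=> x; rewrite mem_rcons inE; apply/predU1P/codomP => [[->|/codomP[k ->]]|[i ->]].
- by exists (s ord_max).
- by exists (s (lift ord_max k)).
rewrite -(permKV s i); case: (unliftP ord_max ((s^-1)%g i)) => [k|] ->.
  by right; exact: (codom_f (fun k => l (s (lift ord_max k)))).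
by left.
Qed.

Context (y : m.+1.-tuple R) (z : R).
Hypotheses (z1 : 1 < z) (y0 : 0 < tnth y ord0)
  (ylt : forall i j : 'I_m.+1, (i < j)%N -> tnth y i < tnth y j).

Let c : R := z * \prod_(i < m.+1) tnth y i.

Let y_gt0 i : 0 < tnth y i.
Proof.
by case: (unliftP ord0 i) => [k|] ->//; rewrite (lt_trans y0)// ylt.
Qed.

Let prody_gt0 : 0 < \prod_(i < m.+1) tnth y i.
Proof. exact: prodr_gt0. Qed.

Let c_gt0 : 0 < c.
Proof. by rewrite mulr_gt0// (lt_trans ltr01). Qed.

(* For each of the first m coordinates, e selects the left endpoint (false) or
   the right endpoint (true) of its interval. *)
Let endpoint (e : {ffun 'I_m -> bool}) (k : 'I_m) : R :=
  tnth y (if e k then lift ord0 k else lift ord_max k).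

(** Each open interval is the open ray at its left end minus the closed ray at its right end;
    distributing the product gives the sum over [e]. The last coordinate is bounded only from below
    and offers no choice. *)
Lemma interlacing_indicator (t : m.-tuple R) :
  (t \in [set t | interlacing_domain y (hypersurface_point c t)])%:R =
  \sum_(e : {ffun 'I_m -> bool}) \prod_k ((-1) ^+ e k *
    (endpoint e k < tnth t k ?<= if e k)%R%:R) *
  (tnth y ord_max < c / \prod_(i < m) tnth t i)%R%:R :> R.
Proof.
rewrite -mulr_suml.
rewrite -(bigA_distr_bigA (fun k (b : bool) => (-1) ^+ b *
  (tnth y (if b then lift ord0 k else lift ord_max k) < tnth t k ?<= if b)%R%:R)) /=.
set x := hypersurface_point c t.
have ylift k : tnth y (lift ord_max k) < tnth y (lift ord0 k).
  by apply: ylt; rewrite lift_max lift0.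
have factorE k : \sum_(b : bool) (-1) ^+ b *
    (tnth y (if b then lift ord0 k else lift ord_max k) < tnth t k ?<= if b)%R%:R =
    ((tnth y (lift ord_max k) < tnth t k) && (tnth t k < tnth y (lift ord0 k)))%R%:R :> R.
  rewrite big_bool /= expr1 expr0 mul1r mulN1r.
  case: ltP => [yt|ty]; last first.
    by rewrite leNgt (le_lt_trans ty (ylift k)) oppr0 addr0.
  by case: ltP => ty; rewrite ?addNr ?oppr0 ?add0r.
rewrite (eq_bigr _ (fun k _ => factorE k)).
have [|] := boolP (t \in _).
  rewrite inE /= => -[_ yx xy].
  rewrite big1 ?mul1r.
    by rewrite -tnth_hypersurface_max yx.
  move=> k _; rewrite -(tnth_hypersurface_lift c) yx xy//.
  by rewrite lift0 lift_max.
move=> tD; apply/esym/eqP; apply: contraR tD; rewrite mulf_eq0 negb_or.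
move=> /andP[/prodf_neq0 tk tmax]; rewrite inE /=; split => //.
- move=> i; case: (unliftP ord_max i) => [k|] ->.
    rewrite tnth_hypersurface_lift; have := tk k isT.
    by case: ltP => //; rewrite eqxx.
  by rewrite tnth_hypersurface_max; move: tmax; case: ltP => //; rewrite eqxx.
move=> i j ji; have im : (i < m)%N by rewrite -ltnS -ji.
have -> : i = lift ord_max (Ordinal im) by apply/val_inj; exact/esym/lift_max.
have -> : j = lift ord0 (Ordinal im) by apply/val_inj; exact: (etrans ji (esym (lift0 _))).
rewrite tnth_hypersurface_lift; have := tk (Ordinal im) isT.
by case: (ltP (tnth t _)) => //; rewrite andbF eqxx.
Qed.

(* If k is the last index with e k = true, the endpoints of indices k and k.+1
   are both y_(k.+1), so the determinant has two equal rows. *)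
Lemma alternant_det_endpoint (l : 'I_m.+1 -> nat) (e : {ffun 'I_m -> bool}) :
  e != [ffun=> false] ->
  \sum_(s : 'S_m.+1) (-1) ^+ s *
    (\prod_k endpoint e k ^+ l (s (lift ord_max k)) * tnth y ord_max ^+ l (s ord_max)) = 0.
Proof.
move=> e0.
have [k0 ek0] : exists k, e k.
  apply/existsP; apply: contraR e0 => /existsPn e0.
  by apply/eqP/ffunP => k; rewrite ffunE; exact/negbTE/e0.
pose k := [arg max_(k > k0 | e k) (k : nat)].
have [ek kmax] : e k /\ forall j, e j -> (j <= k)%N by rewrite /k; case: arg_maxnP.
pose Y i := if unlift ord_max i is Some k then endpoint e k else tnth y i.
have YS j : Y (lift ord_max j) = endpoint e j by rewrite /Y liftK.
have Ym : Y ord_max = tnth y ord_max by rewrite /Y unlift_none.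
pose M : 'M[R]_m.+1 := \matrix_(i, j) Y i ^+ l j.
transitivity (\det M).
  apply: eq_bigr => s _; congr (_ * _); rewrite big_ord_lift_max mxE Ym.
  by congr (_ * _); apply: eq_bigr => j _; rewrite mxE YS.
apply: (determinant_alternate (i1 := lift ord_max k) (i2 := lift ord0 k)).
  by apply/eqP => /(congr1 (@nat_of_ord _)); rewrite lift_max lift0; lia.
move=> j; rewrite !mxE; congr (_ ^+ _); rewrite YS /endpoint ek.
(* If the next row is the last, its entry is that y by construction; otherwise maximality of [k]
   forces its left endpoint. *)
case: (unliftP ord_max (lift ord0 k)) => [k' k'E|->]; last by rewrite Ym.
rewrite k'E YS /endpoint ifF//; apply/negP => /kmax.
by have := congr1 (@nat_of_ord _) k'E; rewrite lift0 lift_max; lia.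
Qed.

(** Determinant and indicator both expand into ray monomials. Part of each value does not depend on
    the permutation, so summing over [s] rebuilds a determinant in the endpoints. *)
Lemma has_complex_integral_alternant (l : 'I_m.+1 -> nat) : injective l ->
  has_complex_integral (lebesgue_tuple R m)
    (fun t => (\det (\matrix_(i, j) tnth (hypersurface_point c t) i ^+ l j) /
       (\prod_(i < m) tnth t i))%:C *
       (t \in [set t | interlacing_domain y (hypersurface_point c t)])%:R)
    (\det (\matrix_(i, j) tnth y i ^+ l j) * pfrac (codom l) z)%:C.
Proof.
move=> lI.
pose h (e : {ffun 'I_m -> bool}) (s : 'S_m.+1) : m.-tuple R -> R :=
  ray_monomial (fun k => l (s (lift ord_max k))) e (endpoint e) (l (s ord_max))
    (tnth y ord_max) c.
pose P e := \prod_k endpoint e k * tnth y ord_max.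
pose V e (s : 'S_m.+1) : R :=
  \prod_k endpoint e k ^+ l (s (lift ord_max k)) * tnth y ord_max ^+ l (s ord_max) *
  ((P e < c)%R%:R * pfrac (codom l) (c / P e)).
have hV e s : has_complex_integral (lebesgue_tuple R m) (fun t => (h e s t)%:C) (V e s)%:C.
  apply: ge0_has_complex_integral.
  - exact: measurable_ray_monomial.
  - by move=> t; apply: ray_monomial_ge0 => // k; exact: y_gt0.
  rewrite integral_ray_monomial//; last first.
  - by move=> k; exact: y_gt0.
  - by rewrite (perm_uniq (perm_codom_lift_max s lI)) map_inj_uniq ?enum_uniq.
  by rewrite (pfrac_perm _ (perm_codom_lift_max s lI)).
pose sgn (e : {ffun 'I_m -> bool}) : R := \prod_k (-1) ^+ e k.
have := has_complex_integral_sum (index_enum {ffun 'I_m -> bool}) (fun e =>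
  has_complex_integralZ (sgn e)%:C
   (has_complex_integral_sum (index_enum 'S_m.+1) (fun s : 'S_m.+1 =>
     has_complex_integralZ ((-1) ^+ s : R)%:C (hV e s)))).
have -> : \sum_e (sgn e)%:C * \sum_(s : 'S_m.+1) ((-1) ^+ s : R)%:C * (V e s)%:C =
    (\sum_e sgn e * \sum_(s : 'S_m.+1) (-1) ^+ s * V e s)%:C.
  rewrite rmorph_sum; apply: eq_bigr => e _; rewrite rmorphM rmorph_sum /=.
  by congr (_ * _); apply: eq_bigr => s _; exact/esym/rmorphM.
have -> : \sum_e sgn e * \sum_(s : 'S_m.+1) (-1) ^+ s * V e s =
    \det (\matrix_(i, j) tnth y i ^+ l j) * pfrac (codom l) z.
  have VE e : \sum_(s : 'S_m.+1) (-1) ^+ s * V e s = (\sum_(s : 'S_m.+1) (-1) ^+ s *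
      (\prod_k endpoint e k ^+ l (s (lift ord_max k)) * tnth y ord_max ^+ l (s ord_max))) *
      ((P e < c)%R%:R * pfrac (codom l) (c / P e)).
    by rewrite mulr_suml; apply: eq_bigr => s _; rewrite -mulrA.
  (* Only the choice of all left endpoints survives; there [P] is the product of the y_i, so c / P =
     z, and P < c because z > 1. *)
  rewrite (bigD1 [ffun=> false])//= [X in _ + X]big1 ?addr0 => [|e e0]; last first.
    by rewrite VE alternant_det_endpoint// mul0r mulr0.
  rewrite /sgn big1 ?mul1r => [|k _]; last by rewrite ffunE.
  have PE : P [ffun=> false] = \prod_i tnth y i.
    rewrite big_ord_lift_max; congr (_ * _); apply: eq_bigr => k _.
    by rewrite /endpoint ffunE.
  have cP : c / P [ffun=> false] = z by rewrite PE /c mulfK// gt_eqF.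
  rewrite VE cP PE ltr_pMl// z1 mul1r; congr (_ * _); apply: eq_bigr => s _.
  congr (_ * _); rewrite big_ord_lift_max mxE; congr (_ * _); apply: eq_bigr => k _.
  by rewrite mxE /endpoint ffunE.
rewrite [X in has_complex_integral _ X _](_ : _ = (fun t =>
    (\det (\matrix_(i, j) tnth (hypersurface_point c t) i ^+ l j) /
      (\prod_(i < m) tnth t i))%:C *
    (t \in [set t | interlacing_domain y (hypersurface_point c t)])%:R))//.
apply/funext => t; rewrite -(rmorph_nat (real_complex R)) interlacing_indicator -rmorphM.
rewrite mulr_sumr rmorph_sum; apply: eq_bigr => e _.
rewrite [X in _ = _ X](_ : _ = sgn e * \sum_(s : 'S_m.+1) (-1) ^+ s * h e s t).
  rewrite rmorphM rmorph_sum /=; congr (_ * _); apply: eq_bigr => s _.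
  exact/esym/rmorphM.
rewrite big_split /= -/(sgn e) -(mulrA (sgn e)) mulrCA; congr (_ * _).
rewrite !mulr_suml; apply: eq_bigr => s _.
rewrite big_ord_lift_max mxE tnth_hypersurface_max /h /ray_monomial !big_split /=.
rewrite -prodfV (eq_bigr (fun k => tnth t k ^+ l (s (lift ord_max k)))); last first.
  by move=> k _; rewrite mxE tnth_hypersurface_lift.
rewrite -!mulrA; congr (_ * (_ * _)); rewrite mulrCA; congr (_ * _); exact: mulrCA.
Qed.

End alternant_integral.

(** * From alternants to all symmetric polynomials *)

Theorem theorem4p1 (R : realType) (m : nat) (z : R) (y : m.+1.-tuple R)
    (Q : {linear sympoly m.+1 R[i] -> sympoly m.+1 R[i]})
    (hQ : forall lam : 'I_m.+1 -> nat, is_partition lam ->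
      Q (schur_bar R[i] lam) = q_eigenvalue lam z%:C *: schur_bar R[i] lam)
    (hz : 1 < z) (hy0 : 0 < tnth y ord0)
    (hy : forall i j : 'I_m.+1, (i < j)%N -> tnth y i < tnth y j)
    (f : sympoly m.+1 R[i]) :
  sympoly_eval (Q f) (fun i => (tnth y i)%:C) =
    (m`!)%:R / ((z - 1) ^+ m * vdm (tnth y))%:C *
    delta_integral (interlacing_domain y) (z * \prod_(i < m.+1) tnth y i)
      (fun x => (vdm (tnth x))%:C * sympoly_eval f (fun i => (tnth x i)%:C)).

Proof.
pose c := z * \prod_(i < m.+1) tnth y i.
pose D := [set t | interlacing_domain y (hypersurface_point c t)].
pose K : R[i] := (m`!)%:R / ((z - 1) ^+ m * vdm (tnth y))%:C.
pose G (f : sympoly m.+1 R[i]) (t : m.-tuple R) : R[i] :=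
  let x := hypersurface_point c t in
  (vdm (tnth x))%:C * sympoly_eval f (fun i => (tnth x i)%:C) /
  (\prod_(i < m) tnth t i)%:C * (t \in D)%:R.
(* The claim includes integrability, so that it passes to sums in the induction on [f]. *)
suff [v Gv QE] : exists2 v, has_complex_integral (lebesgue_tuple R m) (G f) v &
    sympoly_eval (Q f) (fun i => (tnth y i)%:C) = K * v.
  rewrite QE /delta_integral complex_integral_mkcond; congr (_ * _).
  by have [_ _ <-] := Gv.
have yI : injective (tnth y).
  move=> i j yij; apply/val_inj; by case: (ltngtP i j) => // /hy; rewrite yij ltxx.
elim/sympoly_schur_ind: f => [|f g [u Gu Qu] [v Gv Qv]|a f [v Gv Qv]|lam lamP].
- exists 0; last by rewrite linear0 mulr0 sympoly_eval0.
  rewrite (_ : G 0 = fun=> 0); first exact: has_complex_integral0.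
  by apply/funext => t; rewrite /G sympoly_eval0 mulr0 !mul0r.
- exists (u + v); last by rewrite linearD sympoly_evalD Qu Qv mulrDr.
  rewrite (_ : G (f + g) = fun t => G f t + G g t).
    exact: has_complex_integralD.
  by apply/funext => t; rewrite /G sympoly_evalD mulrDr !mulrDl.
- exists (a * v); last by rewrite linearZ sympoly_evalZ Qv mulrCA.
  rewrite (_ : G (a *: f) = fun t => a * G f t).
    exact: has_complex_integralZ.
  by apply/funext => t; rewrite /G sympoly_evalZ [_ * (a * _)]mulrCA -!mulrA.
pose l j := (lam j + (m.+1 - j.+1))%N.
(* [vdm] cancels the denominator of the Schur polynomial, so the integrand is an alternant. *)
have detE (x : m.+1.-tuple R) :
    (vdm (tnth x))%:C * sympoly_eval (schur R[i] lam) (fun i => (tnth x i)%:C) =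
    (\det (\matrix_(i, j) tnth x i ^+ l j))%:C.
  rewrite mulrC -det_map_mx rmorph_vdm sympoly_eval_schur; congr (\det _).
  by apply/matrixP => i j; rewrite !mxE rmorphXn.
exists (\det (\matrix_(i, j) tnth y i ^+ l j) * pfrac (codom l) z)%:C.
  rewrite (_ : G _ = fun t => (\det (\matrix_(i, j)
      tnth (hypersurface_point c t) i ^+ l j) / \prod_(i < m) tnth t i)%:C * (t \in D)%:R).
    exact/has_complex_integral_alternant/partition_exponent_inj.
  by apply/funext => t; rewrite /G detE fmorph_div.
have z1 : z%:C != 1 by rewrite -(rmorph1 (real_complex R)) (inj_eq (fmorph_inj _)) gt_eqF.
have s1 := schur_eval1_neq0 R[i] lamP.
(* [hQ] concerns the normalized polynomial; as the value at (1, ..., 1) is nonzero, [schur] is a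
   multiple of it with the same eigenvalue. *)
have -> : Q (schur R[i] lam) = q_eigenvalue lam z%:C *: schur R[i] lam.
  have sE : schur R[i] lam = sympoly_eval (schur R[i] lam) (fun=> 1) *: schur_bar R[i] lam.
    by rewrite /schur_bar scalerA divff// scale1r.
  rewrite {1}sE linearZ hQ// [in RHS]sE; apply: etrans (scalerA _ _ _) _.
  by rewrite mulrC; exact/esym/scalerA.
(* Both sides reduce to m!/(z-1)^m times s_lam(y) times the divided difference at z, since the
   alternant at [y] divided by [vdm] is s_lam(y). *)
rewrite sympoly_evalZ q_eigenvalueE// rmorphM /= -detE /K -/l.
rewrite -(rmorph_pfrac (real_complex R)) rmorphM rmorphXn rmorphB rmorph1 /=.
have v0 : (vdm (tnth y))%:C != 0 by rewrite fmorph_eq0 vdm_neq0.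
by field; rewrite v0 expf_neq0// subr_eq0.
Qed.
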